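(* Let $f\in C^{0,1}([0,1]^n)$ with $f>0$ on $[0,1]^n$. For $h>0$ let $w_h:[0,1]^n_h\to[0,\infty)$ be the maximal solution of the scheme (S3), and let $w$ be the maximal bounded viscosity solution of (P3) (both defined in the context). Then there is a constant $C>0$ depending only on $n$, $[f]_{1;[0,1]^n}$ and $\inf_{[0,1]^n}f$ such that $$|w(x)-w_h(x)|\le C\sqrt{h}\quad\text{for all }x\in[0,1]^n_h.$$
   Context: $n\ge 1$ is an integer, $a_+=\max(a,0)$, and $\Gamma=\partial[0,1]^n\setminus(0,1]^n$. $[f]_{1;[0,1]^n}=\sup_{x\ne y}|f(x)-f(y)|/|x-y|$ is the Lipschitz seminorm. A function is nondecreasing if it is nondecreasing in each coordinate separately. Grid: for $h>0$, $\mathbb{Z}_h=\{hk:k\in\mathbb{Z}\}$, $\Omega_h=\Omega\cap(\mathbb{Z}_h)^n$, and $D_i^-g(x)=\dfrac{g(x)-g(x-he_i)}{h}$. Problem (P1): $(u_{x_1})_+\cdots(u_{x_n})_+=f$ in $(0,1]^n$, $u=0$ on $\Gamma$. A viscosity solution of (P1) is a continuous $u:[0,1]^n\to\mathbb{R}$ with $u=0$ on $\Gamma$ such that for every $x_0\in(0,1]^n$ and every $C^1$ function $\phi$: if $u-\phi$ has a local maximum (resp. minimum) at $x_0$ relative to $(0,1]^n$, then $\prod_i(\phi_{x_i}(x_0))_+\le f(x_0)$ (resp. $\ge f(x_0)$). For continuous nonnegative $f$ there is a unique nondecreasing viscosity solution $u$ of (P1). Problem (P3): $\prod_{i=1}^n(w+nx_iw_{x_i})_+=f$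 on $(0,1]^n$ (no boundary condition). The maximal bounded viscosity solution of (P3) is $w(x)=n^{-1}(x_1\cdots x_n)^{-1/n}u(x)$ for $x\in(0,1]^n$, where $u$ is the nondecreasing viscosity solution of (P1); it is understood to be extended continuously to $[0,1]^n$. Scheme (S3): $\prod_{i=1}^n\big(w_h(x)+nx_iD_i^-w_h(x)\big)_+=f(x)$ for all $x\in[0,1]^n_h$, where the term $nx_iD_i^-w_h(x)$ is interpreted as $0$ when $x_i=0$. The maximal solution $w_h$ is defined inductively: at each $x$, given the values $w_h(x-he_i)$ for those $i$ with $x_i\neq0$, $w_h(x)$ is the largest real number satisfying the equation at $x$. *)

(* Defs.v *)
From mathcomp Require Import all_boot all_order all_algebra.
From mathcomp Require Import all_classical all_reals all_analysis.

Set Implicit Arguments.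
Unset Strict Implicit.
Unset Printing Implicit Defensive.

Import Order.TTheory GRing.Theory Num.Theory.
Import numFieldNormedType.Exports.

Local Open Scope classical_set_scope.
Local Open Scope ring_scope.

(* Functions given on the cube or on a grid are represented by total functions
   on 'rV[R]_n; only their values on the relevant set are ever constrained. *)

Section Defs.
Context {R : realType} {n : nat}.
Implicit Types (x y : 'rV[R]_n) (f g u w phi : 'rV[R]_n -> R) (h : R).

Definition pos_part (a : R) : R := Num.max a 0.

Definition evec (i : 'I_n) : 'rV[R]_n := delta_mx 0 i.

(* The norm `|x| of the library on 'rV[R]_n is the sup norm. *)
Definition enorm x : R := Num.sqrt (\sum_i x 0 i ^+ 2).

(* [0,1]^n *)
Definition cube : set 'rV[R]_n := [set x | forall i, 0 <= x 0 i <= 1].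

(* (0,1]^n *)
Definition hcube : set 'rV[R]_n := [set x | forall i, 0 < x 0 i <= 1].

Definition Gamma : set 'rV[R]_n := (closure cube `\` interior cube) `\` hcube.

Definition lip_quotients f : set R :=
  [set q | exists x y, [/\ cube x, cube y, x != y &
                           q = `|f x - f y| / enorm (x - y)]].

(* f belongs to C^{0,1}([0,1]^n) *)
Definition lipschitz_cube f : Prop := has_ubound (lip_quotients f).

Definition lip_seminorm f : R := sup (lip_quotients f).

Definition nondecreasing_cube u : Prop :=
  forall x y (i : 'I_n), cube x -> cube y ->
    (forall j, j != i -> x 0 j = y 0 j) -> x 0 i <= y 0 i -> u x <= u y.

Definition C1 phi : Prop :=
  forall i, (forall x, derivable phi x (evec i)) /\
            continuous ('D_(evec i) phi).

Definition P1_op phi x : R := \prod_(i < n) pos_part ('D_(evec i) phi x).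

Definition local_max_hcube g x0 : Prop :=
  \forall y \near x0, hcube y -> g y <= g x0.

Definition local_min_hcube g x0 : Prop :=
  \forall y \near x0, hcube y -> g x0 <= g y.

Definition P1_viscosity_solution f u : Prop :=
  [/\ {within cube, continuous u},
      (forall x, Gamma x -> u x = 0),
      (forall x0 phi, hcube x0 -> C1 phi ->
         local_max_hcube (fun x => u x - phi x) x0 -> P1_op phi x0 <= f x0) &
      (forall x0 phi, hcube x0 -> C1 phi ->
         local_min_hcube (fun x => u x - phi x) x0 -> f x0 <= P1_op phi x0)].

(* The maximal bounded viscosity solution of
     prod_i (w + n x_i w_{x_i})_+ = f  on (0,1]^n
   is given by the change of variables u = n (x_1 ... x_n)^{1/n} w; being
   continuous on the closed cube, w is determined there by its values on the
   dense subset (0,1]^n. *)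
Definition P3_maximal_solution f w : Prop :=
  exists u,
    [/\ nondecreasing_cube u,
        P1_viscosity_solution f u,
        (forall x, hcube x ->
           w x = n%:R^-1 * (\prod_(i < n) x 0 i) `^ (- n%:R^-1) * u x) &
        {within cube, continuous w}].

(* [0,1]^n_h *)
Definition grid h : set 'rV[R]_n :=
  [set x | cube x /\ forall i, exists k : int, x 0 i = h * k%:~R].

Definition Dminus h (i : 'I_n) g x : R := (g x - g (x - h *: evec i)) / h.

(* If x_i = 0, the i-th difference term vanishes whatever the value of g at
   the point x - h e_i, which lies outside the cube. *)
Definition S3_op h g x : R :=
  \prod_(i < n) pos_part (g x + n%:R * x 0 i * Dminus h i g x).

(* At each grid point x, wh x is the largest value v x solving the equation at
   x among the functions v with the same values as wh at the neighbours
   x - h e_i, x_i <> 0. *)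
Definition S3_maximal_solution h f wh : Prop :=
  forall x, grid h x ->
    S3_op h wh x = f x /\
    (forall v : 'rV[R]_n -> R,
       (forall i, x 0 i != 0 -> v (x - h *: evec i) = wh (x - h *: evec i)) ->
       S3_op h v x = f x -> v x <= wh x).

End Defs.

(* Main.v *)
Require Import Defs.
From mathcomp Require Import all_boot all_order all_algebra.
From mathcomp Require Import all_classical all_reals all_analysis.
From mathcomp Require Import ring lra.
Import Order.TTheory GRing.Theory Num.Theory.
Import numFieldNormedType.Exports.
Local Open Scope classical_set_scope.
Local Open Scope ring_scope.

(** The proof is a doubling of variables that needs no Lipschitz bound for [w]
    or for [wh]: the zeroth-order term of the equation does all the work.

    Let [L] and [m] be the Lipschitz constant and the infimum of [f], and let
    [K] be such that [L <= min 1 m * K].  Put [s d = sqrt (|d|^2 + h)], and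
    consider a point [(z, y)] maximising, over [x] in the half-open cube and
    [y] in the grid,
      [w x - wh y - K * s (x - y) + eta * \sum_i ln x_i].
    The logarithms keep [z] away from the faces on which no viscosity
    inequality is available.  In the equation the gradient always comes
    multiplied by [x_i], so they change each factor only by the constant
    [n * eta], wherever the maximum is attained.

    Since [s] has slope [p = (z - y) / s (z - y)], the viscosity inequality for
    [w] at [z] says that the product of the
      [c_i = w z + n K z_i p_i - n eta]
    is at most [f z], while the factors [b_i] of the scheme at [y], whose
    product is [f y], satisfy [b_i <= wh y + n K y_i p_i + n K sqrt h / 2]:
    the second derivatives of [s] are at most [1 / sqrt h].  As
    [(z_i - y_i) p_i >= 0], all the gaps [c_i - b_i] are at least
      [delta = w z - wh y - n K sqrt h / 2 - n eta].
    Adding [delta >= 0] to positive factors of product at least [m] raises the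
    product by at least [min 1 m * delta] ([prod_add_ge]), so that
    [min 1 m * delta <= f z - f y <= L |z - y|], whence
    [delta <= K * s (z - y)].  The penalty in the maximised quantity absorbs
    exactly this term; letting [eta] tend to [0] and then [x] tend to [y],
    where [s 0 = sqrt h], gives
      [w y - wh y <= K (1 + n / 2) sqrt h].
    Exchanging the roles of [w] and [wh] gives the other inequality.

    The equation for [w] is obtained from that of
    [u = n (x_1 ... x_n)^(1/n) w].  All test functions are polynomials: the
    penalties are replaced near [z] by quadratic functions touching them at
    [z], and the geometric mean [(x_1 ... x_n)^(1/n)] is bounded above by an
    arithmetic mean ([gmean_le]) and below by a quadratic polynomial
    ([gmean_ge]), both with its gradient at [z]. *)

(** * Products of positive parts under a uniform shift *)

Section ProductMargin.
Context {R : realType} {n : nat}.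
Implicit Types (b c : 'I_n -> R) (m d K L t : R).

Lemma prod_gt0_all b : (forall i, 0 <= b i) -> 0 < \prod_i b i ->
  forall i, 0 < b i.
Proof.
move=> b0 pb i; rewrite lt_neqAle b0 andbT eq_sym; apply: contraTneq pb => bi0.
by rewrite (bigD1 i) //= bi0 mul0r ltxx.
Qed.

(** If some factor is at most [1], omit that one; otherwise every partial
    product is at least [1]. *)
Lemma exists_coprod_ge b m : (0 < n)%N -> (forall i, 0 < b i) ->
  m <= \prod_i b i -> exists j, Num.min 1 m <= \prod_(i | i != j) b i.
Proof.
move=> n0 b0 mb.
have [[j bj1]|b1] := pselect (exists j, b j <= 1).
  exists j; rewrite ge_min; apply/orP; right; apply: (le_trans mb).
  rewrite (bigD1 j) //= -[leRHS]mul1r ler_wpM2r //.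
  by apply: prodr_ge0 => i _; exact: ltW.
exists (Ordinal n0); rewrite ge_min; apply/orP; left.
apply: (big_ind (fun x : R => 1 <= x)) => //.
  by move=> x y x1 y1; rewrite -[1]mulr1 ler_pM.
move=> i _; have [//|bi] := leP 1 (b i).
by case: b1; exists i; exact: ltW.
Qed.

(** Strict monotonicity of the product in the zeroth-order term: shifting a
    single well-chosen factor by [d] already gains [d] times the product of
    the others.  The factors have no common upper bound, hence the choice of
    the factor in [exists_coprod_ge]. *)
Lemma prod_add_ge b c m d : (0 < n)%N -> (forall i, 0 < b i) ->
  m <= \prod_i b i -> 0 <= d -> (forall i, b i + d <= c i) ->
  \prod_i b i + Num.min 1 m * d <= \prod_i c i.
Proof.
move=> n0 b0 mb d0 bdc; have [j jb] := exists_coprod_ge _ _ n0 b0 mb.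
rewrite (bigD1 j) //= [leRHS](bigD1 j) //=.
set B := \prod_(i | i != j) b i in jb *.
have B0 : 0 <= B by apply: prodr_ge0 => i _; exact: ltW.
have BC : B <= \prod_(i | i != j) c i.
  apply: ler_prod => i _; rewrite ltW //=.
  by apply: le_trans (bdc i); rewrite lerDl.
apply: (@le_trans _ _ ((b j + d) * B)).
  by rewrite mulrDl lerD2l mulrC ler_wpM2l.
apply: ler_pM => //; by rewrite addr_ge0 // ltW.
Qed.

Lemma pos_partZ (c d : R) : 0 <= c -> pos_part (c * d) = c * pos_part d.
Proof. by move=> c0; rewrite /pos_part maxr_pMr// mulr0. Qed.

Lemma pos_part_ge0 (c : R) : 0 <= pos_part c.
Proof. by rewrite le_max lexx orbT. Qed.

Lemma ge_pos_part (c : R) : c <= pos_part c.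
Proof. by rewrite le_max lexx. Qed.

Lemma pos_part_id (c : R) : 0 < pos_part c -> pos_part c = c.
Proof. by rewrite /pos_part; case: (leP c 0) => //; rewrite ltxx. Qed.

(** The comparison mechanism: two families of factors that are [delta] apart,
    but whose products differ by at most [L * t], cannot be further than
    [K * t] apart. *)
Lemma margin_le (b c : 'I_n -> R) L m K (delta t : R) : (0 < n)%N ->
  0 < m -> L <= Num.min 1 m * K -> 0 <= t -> 0 <= K ->
  m <= \prod_i pos_part (b i) -> (forall i, b i + delta <= c i) ->
  \prod_i pos_part (c i) <= \prod_i pos_part (b i) + L * t ->
  delta <= K * t.
Proof.
move=> n0 m0 LK t0 K0 mb bc cb.
have [d0|d0] := leP delta 0; first by rewrite (le_trans d0)// mulr_ge0.
have pb i : 0 < pos_part (b i).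
  apply: (prod_gt0_all (fun i => pos_part (b i))) => [j|].
    exact: pos_part_ge0.
  exact: lt_le_trans mb.
have bc' i : pos_part (b i) + delta <= pos_part (c i).
  by rewrite (pos_part_id _ (pb i)); apply: le_trans (bc i) (ge_pos_part _).
have := prod_add_ge _ _ _ _ n0 pb mb (ltW d0) bc'.
have m1 : 0 < Num.min 1 m by rewrite lt_min ltr01.
move=> H; rewrite -(ler_pM2l m1); have := ler_wpM2r t0 LK; lra.
Qed.

End ProductMargin.

(** * Functions with an explicit continuous gradient *)

Section GradientCalculus.
Context {R : realType} {n : nat}.
Implicit Types (f g : 'rV[R]_n -> R) (df dg : 'I_n -> 'rV[R]_n -> R).

(** Continuity of [f] itself is part of the definition because continuity of
    the gradient of a product requires it. *)
Definition C1_with_grad f df : Prop :=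
  [/\ continuous f, (forall i x, is_derive x (evec i) f (df i x)) &
      (forall i, continuous (df i))].

Lemma C1_with_gradE f df i x : C1_with_grad f df -> 'D_(evec i) f x = df i x.
Proof. by case=> _ + _ => /(_ i x) /@derive_val. Qed.

Lemma C1_with_grad_C1 f df : C1_with_grad f df -> C1 f.
Proof.
move=> fdf i; split=> [x|]; first by have [_ /(_ i x) []] := fdf.
suff -> : 'D_(evec i) f = df i by have [] := fdf.
by apply/funext => x; exact: C1_with_gradE.
Qed.

Lemma C1_with_grad_cst (c : R) : C1_with_grad (fun=> c) (fun=> fun=> 0).
Proof.
split=> [|i x|i]; [exact: cst_continuous|exact: is_derive_cst|].
exact: cst_continuous.
Qed.

Lemma C1_with_grad_coord (j : 'I_n) :
  C1_with_grad (fun x => x 0 j) (fun i => fun=> (i == j)%:R).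
Proof.
split=> [|i x|i]; [exact: coord_continuous| |exact: cst_continuous].
have E : (fun h : R => h^-1 *: ((h *: evec i + x) 0 j - x 0 j)) @ 0^' -->
         ((i == j)%:R : R).
  apply: cvg_near_cst; near=> h.
  rewrite !mxE eqxx /= addrK scalerA mulVf ?mul1r ?scale1r//.
    by rewrite /GRing.scale/= ?mul1r eq_sym.
  near: h; exact: nbhs_dnbhs_neq.
split; first by apply/cvg_ex; exists (i == j)%:R.
exact/cvg_lim.
Unshelve. all: by end_near. Qed.

Lemma C1_with_gradD f g df dg : C1_with_grad f df -> C1_with_grad g dg ->
  C1_with_grad (fun x => f x + g x) (fun i x => df i x + dg i x).
Proof.
case=> f1 f2 f3 [g1 g2 g3]; split=> [x|i x|i x].
- exact: cvgD (f1 x) (g1 x).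
- exact: is_deriveD.
- exact: cvgD (f3 i x) (g3 i x).
Qed.

Lemma C1_with_gradM f g df dg : C1_with_grad f df -> C1_with_grad g dg ->
  C1_with_grad (fun x => f x * g x) (fun i x => f x * dg i x + g x * df i x).
Proof.
case=> f1 f2 f3 [g1 g2 g3]; split=> [x|i x|i x].
- exact: cvgM (f1 x) (g1 x).
- exact: is_deriveM.
- exact: cvgD (cvgM (f1 x) (g3 i x)) (cvgM (g1 x) (f3 i x)).
Qed.

Lemma C1_with_grad_sum (I : Type) (r : seq I) (F : I -> 'rV[R]_n -> R)
    (dF : I -> 'I_n -> 'rV[R]_n -> R) :
  (forall k, C1_with_grad (F k) (dF k)) ->
  C1_with_grad (fun x => \sum_(k <- r) F k x)
               (fun i x => \sum_(k <- r) dF k i x).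
Proof.
move=> FdF; elim: r => [|k r IH].
  under eq_fun do rewrite big_nil.
  by under [X in C1_with_grad _ X]eq_fun do under eq_fun do rewrite big_nil;
    exact: C1_with_grad_cst.
under eq_fun do rewrite big_cons.
under [X in C1_with_grad _ X]eq_fun do under eq_fun do rewrite big_cons.
exact: C1_with_gradD.
Qed.

(** For a sum of functions of one coordinate each, only the [i]-th term
    contributes to the [i]-th derivative. *)
Lemma C1_with_grad_separable (q dq : 'I_n -> 'rV[R]_n -> R) :
  (forall k, C1_with_grad (q k) (fun i x => (i == k)%:R * dq k x)) ->
  C1_with_grad (fun x => \sum_k q k x) dq.
Proof.
move=> qdq; have := C1_with_grad_sum _ (index_enum _) _ _ qdq.
congr C1_with_grad; apply/funext => i; apply/funext => x.
rewrite (bigD1 i) //= eqxx mul1r big1 ?addr0// => k ki.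
by rewrite eq_sym (negbTE ki) mul0r.
Qed.

End GradientCalculus.

(** * Quadratic test functions and the geometric mean *)

Section Quadratic.
Context {R : realType} {n : nat}.
Implicit Types (x z : 'rV[R]_n) (a b : 'I_n -> R).

Definition quad z (c : R) a b x : R :=
  c + \sum_k (a k * (x 0 k - z 0 k) ^+ 2 + b k * (x 0 k - z 0 k)).

Lemma quad_center z c a b : quad z c a b z = c.
Proof.
by rewrite /quad big1 ?addr0// => k _; rewrite subrr expr0n !mulr0 addr0.
Qed.

Lemma C1_with_grad_quad z c a b :
  C1_with_grad (quad z c a b) (fun i x => a i * (x 0 i - z 0 i) *+ 2 + b i).
Proof.
have h1 k : C1_with_grad (fun x : 'rV[R]_n => x 0 k - z 0 k)
    (fun i => fun=> (i == k)%:R + 0).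
  exact: C1_with_gradD (C1_with_grad_coord k) (C1_with_grad_cst _).
have h2 k := C1_with_gradM _ _ _ _ (C1_with_grad_cst (a k))
  (C1_with_gradM _ _ _ _ (h1 k) (h1 k)).
have h3 k := C1_with_gradM _ _ _ _ (C1_with_grad_cst (b k)) (h1 k).
have h k := C1_with_gradD _ _ _ _ (h2 k) (h3 k).
have H : C1_with_grad (fun x => \sum_k (a k * (x 0 k - z 0 k) ^+ 2 +
     b k * (x 0 k - z 0 k))) (fun i x => a i * (x 0 i - z 0 i) *+ 2 + b i).
  apply: C1_with_grad_separable => k; have := h k.
  by congr C1_with_grad; apply/funext => i; apply/funext => x; ring.
have := C1_with_gradD _ _ _ _ (C1_with_grad_cst c) H.
by congr C1_with_grad; apply/funext => i; apply/funext => x; rewrite add0r.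
Qed.

End Quadratic.

Section GeometricMean.
Context {R : realType} {n : nat}.
Implicit Types (x z : 'rV[R]_n).

Lemma ln_le_subr1 (t : R) : 0 < t -> ln t <= t - 1.
Proof. by move=> t0; rewrite lerBrDl -[leRHS]lnK// expR_ge1Dx. Qed.

(** Apply [ln t' <= t' - 1] to [t' = 1 / t], and expand [1 / t] to second
    order, with [1 / t <= 2] in the remainder. *)
Lemma ln_ge_quad (t : R) : 2^-1 <= t -> t - 1 - 2 * (t - 1) ^+ 2 <= ln t.
Proof.
move=> t2; have t0 : 0 < t by apply: lt_le_trans t2.
have := ln_le_subr1 _ ((etrans (invr_gt0 t)) t0).
rewrite lnV// lerNl opprB; apply: le_trans.
have -> : 1 - t^-1 = t - 1 - t^-1 * (t - 1) ^+ 2 by field; rewrite gt_eqF.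
rewrite lerD2l lerN2 ler_wpM2r ?sqr_ge0//.
by rewrite -[leRHS]invrK lef_pV2 ?posrE ?invr_gt0.
Qed.

(** The geometric mean of positive coordinates, in the form that makes its
    ratios computable through logarithms. *)
Definition gmean x : R := expR (n%:R^-1 * \sum_i ln (x 0 i)).

Lemma gmean_gt0 x : 0 < gmean x. Proof. exact: expR_gt0. Qed.

Lemma ln_prod x : (forall i, 0 < x 0 i) ->
  ln (\prod_i x 0 i) = \sum_i ln (x 0 i).
Proof.
move=> x0; rewrite -[RHS]expRK expR_sum; congr ln.
by apply: eq_bigr => i _; rewrite lnK ?posrE.
Qed.

Lemma powR_gmean x (s : R) : (forall i, 0 < x 0 i) ->
  (\prod_i x 0 i) `^ s = expR (s * \sum_i ln (x 0 i)).
Proof.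
move=> x0; rewrite /powR gt_eqF ?ln_prod//.
by apply: prodr_gt0 => i _.
Qed.

Lemma gmeanX x : (0 < n)%N -> (forall i, 0 < x 0 i) ->
  gmean x ^+ n = \prod_i x 0 i.
Proof.
move=> n0 x0; rewrite /gmean -expRM_natl mulrA mulfV ?pnatr_eq0 -?lt0n//.
by rewrite mul1r -ln_prod// lnK// posrE prodr_gt0.
Qed.

Lemma gmean_ratio x z : (forall i, 0 < x 0 i) -> (forall i, 0 < z 0 i) ->
  gmean x = gmean z * expR (n%:R^-1 * \sum_i ln (x 0 i / z 0 i)).
Proof.
move=> x0 z0; rewrite /gmean -expRD -mulrDr -big_split/=.
congr (expR (_ * _)); apply: eq_bigr => i _.
by rewrite ln_div ?posrE// addrC subrK.
Qed.

(** The quadratic on the right is the arithmetic mean of the ratios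
    [x_i / z_i], so this is the arithmetic-geometric inequality.  It follows
    by summing [ln (t_i / A) <= t_i / A - 1], where [A] is the mean of the
    [t_i]. *)
Lemma gmean_le x z : (0 < n)%N ->
  (forall i, 0 < x 0 i) -> (forall i, 0 < z 0 i) ->
  gmean x <= gmean z * quad z 1 (fun=> 0) (fun i => n%:R^-1 / z 0 i) x.
Proof.
move=> n0 x0 z0; rewrite (gmean_ratio _ _ x0 z0) ler_pM2l ?gmean_gt0//.
have n0R : n%:R != 0 :> R by rewrite pnatr_eq0 -lt0n.
set A := quad _ _ _ _ _.
have EA : A = n%:R^-1 * \sum_i x 0 i / z 0 i.
  rewrite /A /quad mulr_sumr -[X in X + _ = _](mulVf n0R).
  rewrite -[X in _ * X%:R + _](card_ord n) -sumr_const mulr_sumr -big_split/=.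
  by apply: eq_bigr => i _; field; rewrite n0R gt_eqF//.
have A0 : 0 < A.
  rewrite EA mulr_gt0 ?invr_gt0 ?ltr0n// (bigD1 (Ordinal n0))//=.
  by rewrite ltr_wpDr ?divr_gt0// sumr_ge0// => i _; rewrite divr_ge0// ltW.
rewrite -[leRHS]lnK ?posrE// ler_expR.
rewrite -subr_le0.
have -> : n%:R^-1 * (\sum_i ln (x 0 i / z 0 i)) - ln A =
   n%:R^-1 * \sum_i ln (x 0 i / z 0 i / A).
  rewrite -[ln A in LHS](mulKf n0R) -mulrBr; congr (_ * _).
  rewrite mulr_natl -[X in _ *+ X](card_ord n) -sumr_const -sumrB.
  by apply: eq_bigr => i _; rewrite [RHS]ln_div ?posrE ?divr_gt0.
have E : n%:R^-1 * \sum_i (x 0 i / z 0 i / A - 1) = 0.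
  rewrite sumrB -mulr_suml sumr_const card_ord mulrBr mulrA -EA.
  by rewrite mulfV ?gt_eqF// mulVf// subrr.
rewrite -[leRHS]E ler_wpM2l ?invr_ge0 ?ler0n// ler_sum// => i _.
by rewrite ln_le_subr1// !divr_gt0.
Qed.

(** Convexity of the exponential, followed by [ln_ge_quad] in each
    coordinate. *)
Lemma gmean_ge x z : (forall i, 0 < z 0 i) -> (forall i, z 0 i / 2 <= x 0 i) ->
  gmean z * quad z 1 (fun i => - (n%:R^-1 * 2 / z 0 i ^+ 2))
                     (fun i => n%:R^-1 / z 0 i) x <= gmean x.
Proof.
move=> z0 zx.
have x0 i : 0 < x 0 i by apply: lt_le_trans (zx i); rewrite divr_gt0.
rewrite (gmean_ratio _ _ x0 z0) ler_pM2l ?gmean_gt0//.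
apply: le_trans (expR_ge1Dx _); rewrite lerD2l mulr_sumr ler_sum// => i _.
have zi : z 0 i != 0 by rewrite gt_eqF.
have -> : - (n%:R^-1 * 2 / z 0 i ^+ 2) * (x 0 i - z 0 i) ^+ 2 +
    n%:R^-1 / z 0 i * (x 0 i - z 0 i) =
   n%:R^-1 * (x 0 i / z 0 i - 1 - 2 * (x 0 i / z 0 i - 1) ^+ 2).
  by set N := n%:R^-1; field.
rewrite ler_wpM2l ?invr_ge0 ?ler0n// ln_ge_quad// ler_pdivlMr// mulrC.
exact: zx.
Qed.

End GeometricMean.

(** * The viscosity inequalities for the rescaled solution *)

Section Viscosity.
Context {R : realType} {n : nat}.
Implicit Types (x y z : 'rV[R]_n) (f u w : 'rV[R]_n -> R) (a b : 'I_n -> R).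

Lemma hcube_gt0 x : hcube x -> forall i, 0 < x 0 i.
Proof. by move=> hx i; have /andP[] := hx i. Qed.

Lemma hcube_cube x : hcube x -> cube x.
Proof. by move=> hx i; have /andP[x0 ->] := hx i; rewrite ltW. Qed.

Lemma face_Gamma z (i : 'I_n) : cube z -> z 0 i = 0 -> Gamma z.
Proof.
move=> cz zi; split; last by move/hcube_gt0 => /(_ i); rewrite zi ltxx.
split; first exact: subset_closure.
rewrite /interior/= => /nbhs_ballP[e /= e0 zb].
have [] // : ~ (0 <= (z - (e / 2) *: evec i) 0 i <= 1).
  by rewrite !mxE !eqxx zi mulr1 sub0r oppr_ge0 leNgt divr_gt0.
apply: (zb (z - (e / 2) *: evec i)).
split=> // j k; rewrite /ball/= !mxE opprB addrCA subrr addr0.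
rewrite normrM ger0_norm ?divr_ge0 ?(ltW e0)// ger0_norm ?ler0n//.
apply: (@le_lt_trans _ _ (e / 2)); last first.
  by rewrite ltr_pdivrMr// ltr_pMr// ltr1n.
by rewrite ler_piMr ?divr_ge0 ?(ltW e0)// lern1 leq_b1.
Qed.

Lemma nondecreasing_solution_ge0 f u : (0 < n)%N -> nondecreasing_cube u ->
  P1_viscosity_solution f u -> forall x, hcube x -> 0 <= u x.
Proof.
move=> n0 un [_ u0 _ _] x hx; set i := Ordinal n0.
pose z : 'rV[R]_n := \row_j (if j == i then 0 else x 0 j).
have cz : cube z.
  by move=> j; rewrite mxE; case: ifP => _;
    [rewrite lexx ler01|exact: hcube_cube].
have zi : z 0 i = 0 by rewrite mxE eqxx.
rewrite -(u0 z (face_Gamma _ _ cz zi)); apply: (un z x i) => //.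
- exact: hcube_cube.
- by move=> j ji; rewrite mxE (negbTE ji).
- by rewrite zi ltW// hcube_gt0.
Qed.

Definition rescaling u w : Prop := forall x, hcube x ->
  w x = n%:R^-1 * (\prod_(i < n) x 0 i) `^ (- n%:R^-1) * u x.

Lemma rescalingE u w : (0 < n)%N -> rescaling u w ->
  forall x, hcube x -> u x = n%:R * gmean x * w x.
Proof.
move=> n0 uw x hx; rewrite uw// powR_gmean; last exact: hcube_gt0.
rewrite mulNr expRN -/(gmean x); field.
by rewrite pnatr_eq0 -lt0n n0 gt_eqF ?gmean_gt0.
Qed.

Lemma rescaling_ge0 u w : (0 < n)%N -> rescaling u w ->
  (forall x, hcube x -> 0 <= u x) -> forall x, hcube x -> 0 <= w x.
Proof.
move=> n0 uw u0 x hx; rewrite uw// !mulr_ge0 ?invr_ge0 ?ler0n ?powR_ge0//.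
exact: u0.
Qed.

(** Test function for [u] at [z] built from the quadratic test function
    [quad z c a b] for [w]; the factor [quad z 1 a1 b1] stands for the ratio
    of geometric means. *)
Definition rescaled_test z a1 b1 c a b x : R :=
  n%:R * gmean z * (quad z 1 a1 b1 x * quad z c a b x).

Lemma rescaled_test_center z a1 b1 c a b :
  rescaled_test z a1 b1 c a b z = n%:R * gmean z * c.
Proof. by rewrite /rescaled_test !quad_center mul1r. Qed.

Lemma rescaled_test_grad z a1 c a b : exists2 df,
  C1_with_grad (rescaled_test z a1 (fun i => n%:R^-1 / z 0 i) c a b) df &
  forall i, df i z = n%:R * gmean z * (b i + c * (n%:R^-1 / z 0 i)).
Proof.
have := C1_with_gradM _ _ _ _ (C1_with_grad_cst (n%:R * gmean z))
 (C1_with_gradM _ _ _ _ (C1_with_grad_quad z 1 a1 (fun i => n%:R^-1 / z 0 i))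
   (C1_with_grad_quad z c a b)).
set df := (X in C1_with_grad _ X) => h; exists df => // i.
by rewrite /df !quad_center subrr !mulr0 mul0rn !add0r addr0 mul1r.
Qed.

(** The change of variables turns one equation into the other: the [i]-th
    derivative of the test function is [gmean z / z_i] times
    [c + n z_i b_i], and the factors [gmean z / z_i] have product [1]. *)
Lemma P1_op_rescaled_test z a1 c a b : (0 < n)%N -> hcube z ->
  P1_op (rescaled_test z a1 (fun i => n%:R^-1 / z 0 i) c a b) z =
  \prod_i pos_part (c + n%:R * z 0 i * b i).
Proof.
move=> n0 hz; have z0 := hcube_gt0 _ hz.
have [df h dfz] := rescaled_test_grad z a1 c a b.
have n0R : n%:R != 0 :> R by rewrite pnatr_eq0 -lt0n.
have gz : \prod_i (gmean z / z 0 i) = 1.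
  rewrite big_split/= prodr_const card_ord gmeanX// prodfV mulfV//.
  by rewrite gt_eqF// prodr_gt0.
transitivity ((\prod_i (gmean z / z 0 i)) *
    \prod_i pos_part (c + n%:R * z 0 i * b i)); last by rewrite gz mul1r.
rewrite /P1_op -big_split/=; apply: eq_bigr => i _.
rewrite (C1_with_gradE _ _ _ _ h) dfz -pos_partZ; last first.
  by rewrite divr_ge0// ltW// gmean_gt0.
congr pos_part; rewrite -[LHS]/(_ * _ * (_ + _)).
by field; rewrite n0R gt_eqF.
Qed.

Lemma near_half_le z : (forall i, 0 < z 0 i) ->
  \forall x \near z, forall i, z 0 i / 2 <= (x : 'rV[R]_n) 0 i.
Proof.
move=> z0; apply: (@filter_forall _ _
  (fun i (x : 'rV[R]_n) => z 0 i / 2 <= x 0 i) _ (nbhs_filter z)) => i.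
have zi : z 0 i / 2 < z 0 i by rewrite ltr_pdivrMr// ltr_pMr// ltr1n.
exact: cvgr_ge (@coord_continuous R _ _ 0 i z) _ zi.
Qed.

(** Where [w] lies below a quadratic, [u = n * gmean * w] lies below the
    product of that quadratic with the affine majorant of [gmean]; this uses
    [0 <= w].  Quadratic test functions are enough for the comparison. *)
Lemma rescaled_subsolution f u w z a b : (0 < n)%N ->
  (forall x, hcube x -> 0 <= u x) -> P1_viscosity_solution f u ->
  rescaling u w -> hcube z ->
  (\forall x \near z, hcube x -> w x <= quad z (w z) a b x) ->
  \prod_i pos_part (w z + n%:R * z 0 i * b i) <= f z.
Proof.
move=> n0 u0 [_ _ subs _] uw hz wq.
have [df h _] := rescaled_test_grad z (fun=> 0) (w z) a b.
rewrite -(P1_op_rescaled_test z (fun=> 0) _ a)//; apply: subs => //.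
  exact: C1_with_grad_C1 h.
rewrite /local_max_hcube; near=> x => hx.
rewrite rescaled_test_center (rescalingE _ _ n0 uw z)// subrr subr_le0.
rewrite (rescalingE _ _ n0 uw)// /rescaled_test -!mulrA ler_pM2l ?ltr0n//.
have wx : w x <= quad z (w z) a b x by move: hx; near: x.
rewrite mulrA ler_pM ?(ltW (gmean_gt0 _)) ?(rescaling_ge0 _ _ n0 uw)//.
by apply: gmean_le => //; exact: hcube_gt0.
Unshelve. all: by end_near. Qed.

(** Here the factor replacing [gmean] is its quadratic minorant.  The test
    quadratic may be negative even though [w] is not, so it is replaced by [w]
    before the minorant is replaced by [gmean]. *)
Lemma rescaled_supersolution f u w z a b : (0 < n)%N ->
  (forall x, hcube x -> 0 <= u x) -> P1_viscosity_solution f u ->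
  rescaling u w -> hcube z ->
  (\forall x \near z, hcube x -> quad z (w z) a b x <= w x) ->
  f z <= \prod_i pos_part (w z + n%:R * z 0 i * b i).
Proof.
move=> n0 u0 [_ _ _ sups] uw hz wq.
set a1 := fun i => - (n%:R^-1 * 2 / z 0 i ^+ 2) : R.
have [df h _] := rescaled_test_grad z a1 (w z) a b.
have [cB _ _] := C1_with_grad_quad z 1 a1 (fun i => n%:R^-1 / z 0 i).
have nB : \forall x \near z, 0 <= quad z 1 a1 (fun i => n%:R^-1 / z 0 i) x.
  have zB : 0 < quad z 1 a1 (fun i => n%:R^-1 / z 0 i) z.
    by rewrite quad_center ltr01.
  exact: cvgr_ge (cB z) _ zB.
rewrite -(P1_op_rescaled_test z a1 _ a)//; apply: sups => //.
  exact: C1_with_grad_C1 h.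
rewrite /local_min_hcube; near=> x => hx.
rewrite rescaled_test_center (rescalingE _ _ n0 uw z)// subrr subr_ge0.
rewrite (rescalingE _ _ n0 uw)// /rescaled_test -!mulrA ler_pM2l ?ltr0n//.
have qx : quad z (w z) a b x <= w x by move: hx; near: x.
have B0 : 0 <= quad z 1 a1 (fun i => n%:R^-1 / z 0 i) x.
  by near: x; exact: nB.
set B := quad z 1 a1 _ x in B0 *.
have Bg : gmean z * B <= gmean x.
  apply: gmean_ge; first by apply: hcube_gt0.
  by near: x; apply: near_half_le; exact: hcube_gt0.
have g0 : 0 <= gmean z * B by rewrite mulr_ge0// ltW// gmean_gt0.
apply: (@le_trans _ _ (gmean z * B * w x)).
  by rewrite mulrA ler_wpM2l.
by rewrite ler_wpM2r// (rescaling_ge0 _ _ n0 uw).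
Unshelve. all: by end_near. Qed.

End Viscosity.

(** * Maxima with a logarithmic barrier *)

Section Compactness.
Context {R : realType} {n : nat}.
Implicit Types (x z : 'rV[R]_n) (v : 'rV[R]_n -> R).

Definition box (r : R) : set 'rV[R]_n := [set x | forall i, r <= x 0 i <= 1].

Lemma box_compact (r : R) : compact (box r).
Proof.
have := @rV_compact R n (fun=> `[r, 1]%classic) (fun=> @segment_compact R r 1).
by congr compact.
Qed.

Lemma continuous_at_sum (F : 'I_n -> 'rV[R]_n -> R) z :
  (forall i, {for z, continuous (F i)}) ->
  {for z, continuous (fun x => \sum_i F i x)}.
Proof.
move=> h; elim: (index_enum _) => [|i r IH].
  rewrite (_ : (fun x => _) = cst 0); first exact: cst_continuous.
  by apply/funext => x; rewrite big_nil.
rewrite (_ : (fun x => _) = fun x => F i x + \sum_(j <- r) F j x).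
  exact: continuousD (h i) IH.
by apply/funext => x; rewrite big_cons.
Qed.

(** The half-open cube is not compact, but the barrier tends to minus infinity
    on the missing faces. *)
Lemma log_penalized_max v eta : 0 < eta -> {within cube, continuous v} ->
  exists2 z, hcube z & forall x, hcube x ->
    v x + eta * \sum_i ln (x 0 i) <= v z + eta * \sum_i ln (z 0 i).
Proof.
move=> eta0 cv; pose one : 'rV[R]_n := const_mx 1.
have hone : hcube one by move=> i; rewrite mxE ltr01 lexx.
have ln_one : \sum_i ln (one 0 i) = 0 :> R.
  by rewrite big1// => i _; rewrite mxE ln1.
have [M vM] : exists M, forall x, cube x -> v x <= M.
  have [|c _ vc] := @EVT_max_rV R n v cube _ (box_compact 0) cv.
    by exists one; exact: hcube_cube.
  by exists (v c) => x cx; apply: vc; rewrite inE.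
(* if [x_i < r], the barrier at [x] outweighs the whole oscillation of [v],
   and the point with all coordinates [1] does better than [x] *)
pose r := expR ((v one - M) / eta).
have r1 : r <= 1.
  rewrite -[leRHS]expR0 ler_expR pmulr_lle0 ?invr_gt0// subr_le0.
  by apply: vM; exact: hcube_cube.
have ln_le0 x i : hcube x -> ln (x 0 i) <= 0.
  by move=> /(_ i)/andP[_]; exact: ln_le0.
pose F x := v x + eta * \sum_i ln (x 0 i).
have cF : {within box r, continuous F}.
  move=> x; apply: cvgD.
    apply: continuous_subspaceW cv x => x hx i; have /andP[rx ->] := hx i.
    by rewrite andbT (le_trans _ rx)// expR_ge0.
  move: x; apply: continuous_in_subspaceT => z; rewrite inE => hz.
  apply: continuousM; first exact: cst_continuous.
  apply: continuous_at_sum => i.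
  apply: continuous_comp; first exact: coord_continuous.
  apply: continuous_ln.
  by have /andP[rz _] := hz i; apply: lt_le_trans rz; exact: expR_gt0.
have [|z] := EVT_max_rV _ (box_compact r) cF.
  by exists one => i; rewrite mxE r1 lexx.
rewrite inE => hz Fz; exists z => [i|x hx].
  by have /andP[rz ->] := hz i; rewrite andbT (lt_le_trans _ rz)// expR_gt0.
have [bx|] := pselect (forall i, r <= x 0 i <= 1).
  by apply: Fz; rewrite inE.
move/existsNP => [i /negP]; have /andP[xi0 ->] := hx i.
rewrite andbT -ltNge => xr.
have Fone : v one <= F z.
  rewrite -[leLHS]addr0 -[X in _ + X <= _](mulr0 eta) -ln_one; apply: Fz.
  by rewrite inE => j; rewrite mxE r1 lexx.
apply: le_trans Fone.
have lnS : \sum_i ln (x 0 i) <= (v one - M) / eta.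
  rewrite (bigD1 i)//= -[leRHS]addr0 lerD//; last first.
    by apply: sumr_le0 => j _; exact: ln_le0.
  by rewrite -[leRHS]expRK ler_ln ?posrE ?expR_gt0// ltW.
have := vM _ (hcube_cube _ hx).
move: lnS; rewrite ler_pdivlMr// => lnS vxM.
by rewrite mulrC; lra.
Qed.

End Compactness.

(** * Lipschitz data on the cube *)

Section Lipschitz.
Context {R : realType} {n : nat}.
Implicit Types (x y : 'rV[R]_n) (f v : 'rV[R]_n -> R).

(** Every point of the cube is the end of a segment inside the half-open cube,
    directed towards the vertex with all coordinates [1]. *)
Lemma le_cube_of_le_hcube v (c : R) : {within cube, continuous v} ->
  (forall x, hcube x -> v x <= c) -> forall x, cube x -> v x <= c.
Proof.
move=> cv vc x cx; pose p (t : R) : 'rV[R]_n := x + t *: (const_mx 1 - x).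
have cp : p t @[t --> 0^'+] --> x.
  have p0 : p 0 = x by rewrite /p scale0r addr0.
  have cp0 : {for 0, continuous p}.
    apply: continuousD; first exact: cst_continuous.
    by apply: continuousZl; exact: cvg_id.
  by apply: cvg_at_right_filter; rewrite -[X in _ --> X]p0; exact: cp0.
have hp : \forall t \near 0^'+, hcube (p t).
  near=> t => i; rewrite !mxE.
  have t0 : 0 < t by near: t; exact: nbhs_right_gt.
  have t1 : t < 1 by near: t; exact: nbhs_right_lt.
  have /andP[xi0 xi1] := cx i.
  have tx0 : 0 <= (1 - t) * x 0 i by rewrite mulr_ge0// subr_ge0 ltW.
  have tx1 : 0 <= (1 - t) * (1 - x 0 i) by rewrite mulr_ge0 ?subr_ge0// ltW.
  by apply/andP; split; lra.
have cvp : v (p t) @[t --> 0^'+] --> v x.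
  apply: (@cvg_comp _ _ _ p v _ (within cube (nbhs x))).
    move=> P /= xP; have := cp _ xP; apply: filterS2 hp => t hpt; apply.
    exact: hcube_cube.
  by move/subspace_continuousP: cv => /(_ x cx).
by apply: (cvgr_to_le cvp); apply: filterS hp => t; exact: vc.
Unshelve. all: by end_near. Qed.

Definition sqn x : R := \sum_i x 0 i ^+ 2.

Lemma sqn_ge0 x : 0 <= sqn x.
Proof. by apply: sumr_ge0 => i _; rewrite sqr_ge0. Qed.

Lemma sqn_continuous : continuous sqn.
Proof.
move=> z; apply: continuous_at_sum => i.
by apply: continuousM; exact: coord_continuous.
Qed.

Lemma enorm_eq0 x : (enorm x == 0) = (x == 0).
Proof.
rewrite sqrtr_eq0; apply/idP/eqP => [x0|->]; last first.
  by rewrite big1// => i _; rewrite mxE expr0n.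
apply/rowP => i; rewrite mxE; apply/eqP; rewrite -sqrf_eq0 eq_le sqr_ge0 andbT.
apply: le_trans x0; rewrite (bigD1 i)//= lerDl.
by apply: sumr_ge0 => j _; rewrite sqr_ge0.
Qed.

Lemma lip_seminormP f : lipschitz_cube f -> forall x y, cube x -> cube y ->
  `|f x - f y| <= lip_seminorm f * enorm (x - y).
Proof.
move=> lf x y cx cy; have [->|xy] := eqVneq x y.
  by rewrite !subrr normr0 (eqP (_ : enorm 0 == 0)) ?mulr0// enorm_eq0.
have e0 : 0 < enorm (x - y).
  by rewrite lt_neqAle sqrtr_ge0 andbT eq_sym enorm_eq0 subr_eq0.
by rewrite -ler_pdivrMr//; apply: ub_le_sup => //; exists x, y.
Qed.

Lemma lipschitz_continuous f : lipschitz_cube f -> {within cube, continuous f}.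
Proof.
move=> lf; apply/subspace_continuousP => x cx.
have ce : {for x, continuous (fun y => lip_seminorm f * enorm (x - y))}.
  apply: continuousM; first exact: cst_continuous.
  apply: (continuous_comp _ (@sqrt_continuous R _)).
  apply: (@continuous_comp _ _ _ (fun y => x - y) sqn).
    by apply: continuousB; [exact: cst_continuous|exact: cvg_id].
  exact: sqn_continuous.
have enorm0 : enorm (0 : 'rV[R]_n) = 0 by apply/eqP; rewrite enorm_eq0.
have ce0 : lip_seminorm f * enorm (x - y) @[y --> x] --> (0 : R).
  rewrite -[X in _ --> X](_ : lip_seminorm f * enorm (x - x) = 0).
    exact: ce.
  by rewrite subrr enorm0 mulr0.
apply/cvgrPdist_lt => e e0; rewrite near_withinE; near=> y => cy.
apply: le_lt_trans (lip_seminormP _ lf _ _ cx cy) _.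
by near: y; exact: (cvgr_lt _ ce0).
Unshelve. all: by end_near. Qed.

Lemma inf_cube_gt0 f : lipschitz_cube f -> (forall x, cube x -> 0 < f x) ->
  0 < inf (f @` cube) /\ forall x, cube x -> inf (f @` cube) <= f x.
Proof.
move=> lf f0; have c1 : cube (const_mx 1 : 'rV[R]_n).
  by move=> i; rewrite mxE ler01 lexx.
have [|c] := @EVT_min_rV R n f cube _ (box_compact 0)
  (lipschitz_continuous _ lf).
  by exists (const_mx 1).
rewrite inE => cc fc; split.
  apply: (lt_le_trans (f0 c cc)); apply: lb_le_inf.
    by exists (f (const_mx 1)); exists (const_mx 1).
  by move=> _ [x cx <-]; apply: fc; rewrite inE.
move=> x cx; apply: ge_inf; last by exists x.
by exists 0 => _ [y cy <-]; exact/ltW/f0.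
Qed.

End Lipschitz.

(** * The smoothed Euclidean norm *)

Section Penalty.
Context {R : realType} {n : nat}.
Implicit Types (x y d e z : 'rV[R]_n) (h : R).

(** Smoothing at length [sqrt h] balances the error [sqrt h] made at the origin
    against the consistency error [h / sqrt h] of a difference quotient of
    step [h]. *)
Definition smooth_norm h d : R := Num.sqrt (sqn d + h).

Lemma sqr_smooth_norm h d : 0 < h -> smooth_norm h d ^+ 2 = sqn d + h.
Proof. by move=> h0; rewrite sqr_sqrtr// addr_ge0 ?sqn_ge0 ?ltW. Qed.

Lemma sqrt_le_smooth_norm h d : Num.sqrt h <= smooth_norm h d.
Proof. by rewrite ler_wsqrtr// lerDr sqn_ge0. Qed.

Lemma smooth_norm_gt0 h d : 0 < h -> 0 < smooth_norm h d.
Proof.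
by move=> h0; apply: lt_le_trans (sqrt_le_smooth_norm _ _); rewrite sqrtr_gt0.
Qed.

Lemma enorm_le_smooth_norm h d : 0 < h -> enorm d <= smooth_norm h d.
Proof. by move=> h0; rewrite ler_wsqrtr// lerDl ltW. Qed.

Lemma smooth_norm0 h : smooth_norm h 0 = Num.sqrt h.
Proof.
by rewrite /smooth_norm /sqn big1 ?add0r// => i _; rewrite mxE expr0n.
Qed.

Lemma smooth_norm_continuous h : continuous (smooth_norm h).
Proof.
move=> d; have c : {for d, continuous (fun d => sqn d + h)}.
  by apply: continuousD; [exact: sqn_continuous|exact: cst_continuous].
exact: (continuous_comp c (@sqrt_continuous R _)).
Qed.

(** The square root is concave: as a function of [|e|^2] it lies below its
    tangent.  This gives a quadratic majorant of the norm that holds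
    everywhere, so that the norm itself is never differentiated. *)
Lemma smooth_norm_tangent h d e : 0 < h ->
  smooth_norm h e - smooth_norm h d <= (sqn e - sqn d) / (2 * smooth_norm h d).
Proof.
move=> h0; have p0 := smooth_norm_gt0 _ d h0.
rewrite ler_pdivlMr ?mulr_gt0//.
have -> : sqn e - sqn d = smooth_norm h e ^+ 2 - smooth_norm h d ^+ 2.
  by rewrite !sqr_smooth_norm//; ring.
have := sqr_ge0 (smooth_norm h e - smooth_norm h d); rewrite sqrrB; lra.
Qed.

Lemma smooth_norm_step h d (i : 'I_n) : 0 < h ->
  smooth_norm h (d + h *: evec i) - smooth_norm h d <=
  h * (d 0 i / smooth_norm h d + Num.sqrt h / 2).
Proof.
move=> h0; apply: (le_trans (smooth_norm_tangent _ _ _ h0)).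
have p0 := smooth_norm_gt0 _ d h0; set p := smooth_norm h d in p0 *.
have -> : sqn (d + h *: evec i) - sqn d = h * (2 * d 0 i + h).
  rewrite /sqn -sumrB (bigD1 i)//= big1 ?addr0; last first.
    by move=> j ji; rewrite !mxE eqxx (negbTE ji) mulr0 addr0 subrr.
  by rewrite !mxE !eqxx mulr1; ring.
have -> : h * (2 * d 0 i + h) / (2 * p) = h * (d 0 i / p + h / p / 2).
  by field; rewrite gt_eqF.
rewrite ler_pM2l// lerD2l ler_pM2r// ler_pdivrMr//.
rewrite -{1}(sqr_sqrtr (ltW h0)) expr2 ler_pM2l ?sqrtr_gt0//.
exact: sqrt_le_smooth_norm.
Qed.

(** Coefficients at [z] of a quadratic touching from above the total penalty
    [K * smooth_norm h (x - y) - eta * \sum_i ln x_i]; [pen_grad] is its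
    gradient there. *)
Definition pen_hess (K eta h : R) y z (k : 'I_n) : R :=
  K / (2 * smooth_norm h (z - y)) + 2 * eta / z 0 k ^+ 2.

Definition pen_grad (K eta h : R) y z (k : 'I_n) : R :=
  K * (z 0 k - y 0 k) / smooth_norm h (z - y) - eta / z 0 k.

Lemma penalty_le_quad (K eta h : R) y z x : 0 < h -> 0 <= K -> 0 <= eta ->
  (forall i, 0 < z 0 i) -> (forall i, z 0 i / 2 <= x 0 i) ->
  K * (smooth_norm h (x - y) - smooth_norm h (z - y)) -
    eta * (\sum_i ln (x 0 i) - \sum_i ln (z 0 i)) <=
  quad z 0 (pen_hess K eta h y z) (pen_grad K eta h y z) x.
Proof.
move=> h0 K0 eta0 z0 zx; have p0 := smooth_norm_gt0 _ (z - y) h0.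
have xK := ler_wpM2l K0 (smooth_norm_tangent _ (z - y) (x - y) h0).
have lnx : \sum_i (x 0 i / z 0 i - 1 - 2 * (x 0 i / z 0 i - 1) ^+ 2) <=
    \sum_i ln (x 0 i) - \sum_i ln (z 0 i).
  rewrite -sumrB ler_sum// => i _.
  have x0 : 0 < x 0 i by apply: lt_le_trans (zx i); rewrite divr_gt0.
  rewrite -ln_div ?posrE// ln_ge_quad// ler_pdivlMr// mulrC; exact: zx.
apply: le_trans (lerB xK (ler_wpM2l eta0 lnx)) _.
rewrite /quad add0r /sqn -sumrB mulr_suml !mulr_sumr -sumrB ler_sum// => i _.
rewrite /pen_hess /pen_grad !mxE; set p := smooth_norm _ _ in p0 *.
rewrite le_eqVlt; apply/orP; left; apply/eqP.
by field; rewrite !gt_eqF.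
Qed.

End Penalty.

(** * The grid *)

Section Grid.
Context {R : realType} {n : nat}.
Implicit Types (x y : 'rV[R]_n) (h : R).

Lemma grid_argmax h (F : 'rV[R]_n -> R) : 0 < h ->
  exists2 y, grid h y & forall x, grid h x -> F x <= F y.
Proof.
move=> h0; set N := Num.truncn h^-1.
pose pt (k : {ffun 'I_n -> 'I_N.+1}) : 'rV[R]_n := \row_i (h * (k i)%:R).
have pt_grid k : grid h (pt k).
  split=> i; rewrite mxE; last by exists (k i : nat).
  rewrite (mulr_ge0 (ltW h0) (ler0n _ _)) /= -ler_pdivlMl// mulr1.
  by rewrite -truncn_ge_nat ?invr_ge0 ?(ltW h0)// -ltnS.
have [k _ kmax] := arg_maxP (fun k => F (pt k)) (erefl (predT [ffun=> ord0])).
exists (pt k) => // x [cx gx].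
have [m xm] := choice gx.
suff -> : x = pt [ffun i => inord `|m i|%N] by exact: kmax.
apply/rowP => i; rewrite mxE ffunE; have /andP[] := cx i.
rewrite xm pmulr_rge0// ler0z => m0; rewrite -ler_pdivlMl// mulr1 => m1.
rewrite -{1}[m i]gez0_abs// inordK// ltnS truncn_ge_nat ?invr_ge0 ?(ltW h0)//.
by move: m1; rewrite -{1}[m i]gez0_abs.
Qed.

Lemma grid_step h x (i : 'I_n) : 0 < h -> grid h x -> x 0 i != 0 ->
  grid h (x - h *: evec i).
Proof.
move=> h0 [cx gx] xi0.
have E j : (x - h *: evec i) 0 j = x 0 j - h * (j == i)%:R.
  by rewrite !mxE eqxx.
split=> j; rewrite E.
  have [->|ji] := eqVneq j i; last by rewrite mulr0 subr0.
  have /andP[] := cx i; have [m xm] := gx i; move: xi0; rewrite xm mulr1.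
  rewrite mulf_eq0 gt_eqF//= intr_eq0 pmulr_rge0// ler0z => m0 mge0 m1.
  have m1' : 1 <= m by rewrite -gtz0_ge1 lt_neqAle eq_sym m0.
  rewrite -[X in h * _ - X]mulr1 -mulrBr pmulr_rge0// subr_ge0 ler1z m1'/=.
  by apply: le_trans m1; rewrite ler_pM2l// gerBl.
have [m xm] := gx j; exists (m - (j == i)%:R).
rewrite xm -mulrBr; congr (_ * _).
by rewrite intrB; case: eqP.
Qed.

End Grid.

(** * Doubling of variables *)

Section Doubling.
Context {R : realType} {n : nat}.
Implicit Types (x y z : 'rV[R]_n) (f w wh v vh : 'rV[R]_n -> R).
Implicit Types (h K eta L m : R).

(** With two functions [v] and [vh] that are added, one statement covers both
    [w - wh] and [wh - w]. *)
Definition doubling_maximizer v vh K eta h z y : Prop :=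
  forall x y', hcube x -> grid h y' ->
    v x + vh y' - K * smooth_norm h (x - y') + eta * \sum_i ln (x 0 i) <=
    v z + vh y - K * smooth_norm h (z - y) + eta * \sum_i ln (z 0 i).

Lemma continuous_subB_smooth_norm v K h y : {within cube, continuous v} ->
  {within cube, continuous (fun x => v x - K * smooth_norm h (x - y))}.
Proof.
move=> cv; have cs x : {for x, continuous (fun x => K * smooth_norm h (x - y))}.
  apply: continuousM; first exact: cst_continuous.
  apply: (@continuous_comp _ _ _ (fun x => x - y) (smooth_norm h)).
    by apply: continuousB; [exact: cvg_id|exact: cst_continuous].
  exact: smooth_norm_continuous.
by move=> x; apply: cvgB; [exact: cv|exact: (continuous_subspaceT cs)].
Qed.

Lemma exists_doubling_maximizer v vh K eta h : 0 < h -> 0 < eta ->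
  {within cube, continuous v} ->
  exists z y, [/\ hcube z, grid h y & doubling_maximizer v vh K eta h z y].
Proof.
move=> h0 eta0 cv.
have /choice[pt ptP] y : exists z, hcube z /\ forall x, hcube x ->
    v x - K * smooth_norm h (x - y) + eta * \sum_i ln (x 0 i) <=
    v z - K * smooth_norm h (z - y) + eta * \sum_i ln (z 0 i).
  have cvy := continuous_subB_smooth_norm _ K h y cv.
  by have [z hz zP] := log_penalized_max _ _ eta0 cvy; exists z.
have [y gy yP] := grid_argmax _ (fun y => vh y + (v (pt y) -
  K * smooth_norm h (pt y - y) + eta * \sum_i ln (pt y 0 i))) h0.
have [hz _] := ptP y; exists (pt y), y; split=> // x y' hx gy'.
have [_ /(_ x hx)] := ptP y'; have := yP _ gy'; lra.
Qed.

(** If at each maximiser the penalty controls [v + vh] up to an error, then the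
    maximum is bounded by that error alone, because the barrier is nonpositive.
    The maximum bounds [v x + vh y] for each fixed [x] in the half-open cube,
    where the barrier vanishes with [eta]; continuity of [v] then allows
    [x = y]. *)
Lemma doubling_bound v vh K h (C : R) : 0 < h -> {within cube, continuous v} ->
  (forall eta z y, 0 < eta -> hcube z -> grid h y ->
    doubling_maximizer v vh K eta h z y ->
    v z + vh y <= K * smooth_norm h (z - y) + C + n%:R * eta) ->
  forall y, grid h y -> v y + vh y <= K * Num.sqrt h + C.
Proof.
move=> h0 cv vC y gy.
have cvy := continuous_subB_smooth_norm _ K h y cv.
suff H x : hcube x -> v x - K * smooth_norm h (x - y) <= C - vh y.
  have := le_cube_of_le_hcube _ _ cvy H _ (proj1 gy).
  by rewrite subrr smooth_norm0; lra.
move=> hx; apply/ler_addgt0Pr => e e0.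
have lnx0 : \sum_i ln (x 0 i) <= 0.
  by apply: sumr_le0 => i _; apply: ln_le0; have /andP[] := hx i.
set S := \sum_i ln (x 0 i) in lnx0.
have D0 : 0 < n%:R - S + 1 by rewrite ltr_wpDl// subr_ge0 (le_trans lnx0).
(* so small that barrier and error terms at [x] add up to less than [e] *)
have eta0 : 0 < e / (n%:R - S + 1) by rewrite divr_gt0.
have etaE : e / (n%:R - S + 1) * (n%:R - S + 1) = e by rewrite divfK ?gt_eqF.
set eta := e / _ in eta0 etaE.
have [z [y0 [hz gy0 zP]]] := exists_doubling_maximizer v vh K _ _ h0 eta0 cv.
have lnz0 : eta * \sum_i ln (z 0 i) <= 0.
  rewrite pmulr_rle0//; apply: sumr_le0 => i _; apply: ln_le0.
  by have /andP[] := hz i.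
have := vC _ _ _ eta0 hz gy0 zP; have := zP _ _ hx gy; rewrite -/S; nra.
Qed.

(** Maximality in the grid variable, tested at the neighbours of [y], bounds
    the differences of [vh] by those of the penalty.  Where [y_i = 0] the
    neighbour is outside of the grid, but then the term vanishes. *)
Lemma scheme_increment vh K h z y : 0 < h -> 0 <= K -> grid h y ->
  (forall y', grid h y' -> vh y' - K * smooth_norm h (z - y') <=
                           vh y - K * smooth_norm h (z - y)) ->
  forall i, - (n%:R * y 0 i * Dminus h i vh y) <=
    n%:R * K * (y 0 i * (z 0 i - y 0 i) / smooth_norm h (z - y)) +
    n%:R * K * Num.sqrt h / 2.
Proof.
move=> h0 K0 gy yP i; have s0 : 0 <= n%:R * K * Num.sqrt h / 2.
  by rewrite !mulr_ge0 ?ler0n ?sqrtr_ge0.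
have [yi0|yi0] := eqVneq (y 0 i) 0.
  by rewrite yi0 !(mulr0, mul0r) oppr0 add0r.
have := yP _ (grid_step _ _ _ h0 gy yi0).
have -> : z - (y - h *: evec i) = z - y + h *: evec i.
  by rewrite opprB addrCA addrC.
set d := z - y; set s := smooth_norm h d; set s' := smooth_norm h _ => vhK.
have sK : K * (s' - s) <= K * (h * (d 0 i / s + Num.sqrt h / 2)).
  by apply: ler_wpM2l => //; exact: smooth_norm_step.
have dvh : vh (y - h *: evec i) - vh y <=
    K * (h * (d 0 i / s + Num.sqrt h / 2)) by lra.
have /andP[y0 y1] := (proj1 gy) i.
have Dvh : - Dminus h i vh y <=
    K * (d 0 i / s + Num.sqrt h / 2).
  by rewrite /Dminus -mulNr opprB ler_pdivrMr// -mulrA [_ * h]mulrC.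
have ny0 : 0 <= n%:R * y 0 i by rewrite mulr_ge0 ?ler0n.
have sy : n%:R * K * Num.sqrt h / 2 * y 0 i <= n%:R * K * Num.sqrt h / 2.
  by rewrite ler_piMr.
have yD : n%:R * y 0 i * - Dminus h i vh y <=
    n%:R * y 0 i * (K * (d 0 i / s + Num.sqrt h / 2)) by exact: ler_wpM2l.
have -> : z 0 i - y 0 i = d 0 i by rewrite !mxE.
by rewrite -mulrN; lra.
Qed.

End Doubling.

(** * Comparison of the scheme with the equation *)

Section Comparison.
Context {R : realType} {n : nat} (f u w wh : 'rV[R]_n -> R) (L m K h : R).
Implicit Types (x y z : 'rV[R]_n).
Context (n_gt0 : (0 < n)%N) (h_gt0 : 0 < h) (m_gt0 : 0 < m).
Context (L_ge0 : 0 <= L) (K_ge0 : 0 <= K) (L_le : L <= Num.min 1 m * K).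
Context (f_ge : forall x, cube x -> m <= f x).
Context (f_lip : forall x y, cube x -> cube y ->
  `|f x - f y| <= L * enorm (x - y)).
Context (u_ge0 : forall x, hcube x -> 0 <= u x).
Context (u_sol : P1_viscosity_solution f u) (uw : rescaling u w).
Context (w_cont : {within cube, continuous w}).
Context (wh_sol : forall x, grid h x -> S3_op h wh x = f x).

Lemma f_dist_le x y : cube x -> cube y ->
  f x <= f y + L * smooth_norm h (x - y) /\
  f y <= f x + L * smooth_norm h (x - y).
Proof.
move=> cx cy; have /ler_normlP[fyx fxy] := f_lip _ _ cx cy.
have Ls : L * enorm (x - y) <= L * smooth_norm h (x - y).
  by rewrite ler_wpM2l// enorm_le_smooth_norm.
split.
  have : f x - f y <= L * smooth_norm h (x - y) by exact: le_trans fxy Ls.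
  by lra.
have : - (f x - f y) <= L * smooth_norm h (x - y) by exact: le_trans fyx Ls.
by lra.
Qed.

(** The gradient is evaluated at [z] in the equation and at [y] in the scheme.
    The resulting difference [n K (z_i - y_i) p_i] has a favourable sign in
    both comparisons and is simply dropped. *)
Lemma cross_term_ge0 z y i :
  0 <= n%:R * K * ((z 0 i - y 0 i) ^+ 2 / smooth_norm h (z - y)) :> R.
Proof.
rewrite (mulr_ge0 (mulr_ge0 (ler0n _ _) K_ge0))// divr_ge0 ?sqr_ge0//.
by rewrite ltW// smooth_norm_gt0.
Qed.

Lemma pen_gradE eta z y i : hcube z ->
  n%:R * z 0 i * pen_grad K eta h y z i =
  n%:R * K * (z 0 i * (z 0 i - y 0 i) / smooth_norm h (z - y)) - n%:R * eta.
Proof.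
move=> hz; rewrite /pen_grad; have s0 := smooth_norm_gt0 h (z - y) h_gt0.
by field; rewrite !gt_eqF// hcube_gt0.
Qed.

Lemma sub_margin eta z y : 0 < eta -> hcube z -> grid h y ->
  doubling_maximizer w (fun x => - wh x) K eta h z y ->
  w z - wh y <= K * smooth_norm h (z - y) + n%:R * K * Num.sqrt h / 2 +
                n%:R * eta.
Proof.
move=> eta0 hz gy zP; have z0 := hcube_gt0 _ hz.
have cz := hcube_cube _ hz; have [cy _] := gy.
have s0 := smooth_norm_gt0 h (z - y) h_gt0.
have visc :
    \prod_i pos_part (w z + n%:R * z 0 i * pen_grad K eta h y z i) <= f z.
  apply: (rescaled_subsolution _ _ _ _ (pen_hess K eta h y z) _
    n_gt0 u_ge0 u_sol uw hz).
  apply: filterS (near_half_le _ z0) => x zx hx.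
  have := zP x y hx gy.
  have := penalty_le_quad K eta h y z x h_gt0 K_ge0 (ltW eta0) z0 zx.
  by rewrite /quad add0r; lra.
have step i := scheme_increment (fun x => - wh x) K h z y h_gt0 K_ge0 gy
  (fun y' gy' => ltac:(have := zP z y' hz gy'; lra)) i.
have fE : \prod_i pos_part (wh y + n%:R * y 0 i * Dminus h i wh y) = f y.
  exact: wh_sol.
suff : w z - wh y - n%:R * K * Num.sqrt h / 2 - n%:R * eta <=
    K * smooth_norm h (z - y) by lra.
apply: (margin_le (fun i => wh y + n%:R * y 0 i * Dminus h i wh y) _
  L m _ _ _ n_gt0 m_gt0 L_le (ltW s0) K_ge0 _ _ (le_trans visc _)).
- by rewrite fE f_ge.
- move=> i; rewrite pen_gradE//; move: (step i) (cross_term_ge0 z y i).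
  have -> : Dminus h i (fun x => - wh x) y = - Dminus h i wh y.
    by rewrite /Dminus -mulNr opprB opprK addrC.
  lra.
- by rewrite fE; have [] := f_dist_le _ _ cz cy.
Qed.

(** For the lower bound on [w], the factors of the equation at [z] are the
    smaller ones, and those of the scheme at [y] the larger ones. *)
Lemma super_margin eta z y : 0 < eta -> hcube z -> grid h y ->
  doubling_maximizer (fun x => - w x) wh K eta h z y ->
  - w z + wh y <= K * smooth_norm h (z - y) + n%:R * K * Num.sqrt h / 2 +
                n%:R * eta.
Proof.
move=> eta0 hz gy zP; have z0 := hcube_gt0 _ hz.
have cz := hcube_cube _ hz; have [cy _] := gy.
have s0 := smooth_norm_gt0 h (z - y) h_gt0.
have visc : f z <=
    \prod_i pos_part (w z + n%:R * z 0 i * - pen_grad K eta h y z i).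
  apply: (rescaled_supersolution _ _ _ _ (fun i => - pen_hess K eta h y z i) _
    n_gt0 u_ge0 u_sol uw hz).
  apply: filterS (near_half_le _ z0) => x zx hx.
  have := zP x y hx gy.
  have := penalty_le_quad K eta h y z x h_gt0 K_ge0 (ltW eta0) z0 zx.
  rewrite /quad add0r; under [X in _ -> _ -> _ + X <= _]eq_bigr do
    rewrite !mulNr -opprD.
  by rewrite sumrN; lra.
have step i := scheme_increment wh K h z y h_gt0 K_ge0 gy
  (fun y' gy' => ltac:(have := zP z y' hz gy'; lra)) i.
have fE : \prod_i pos_part (wh y + n%:R * y 0 i * Dminus h i wh y) = f y.
  exact: wh_sol.
suff : wh y - w z - n%:R * K * Num.sqrt h / 2 - n%:R * eta <=
    K * smooth_norm h (z - y) by lra.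
apply: (margin_le _ (fun i => wh y + n%:R * y 0 i * Dminus h i wh y)
  L m _ _ _ n_gt0 m_gt0 L_le (ltW s0) K_ge0 (le_trans (f_ge _ cz) visc)).
- move=> i; rewrite mulrN pen_gradE//.
  by move: (step i) (cross_term_ge0 z y i); lra.
- rewrite fE; have [_ fyz] := f_dist_le _ _ cz cy.
  by apply: (le_trans fyz); rewrite lerD2r.
Qed.

Lemma comparison_estimate y : grid h y ->
  `|w y - wh y| <= K * (1 + n%:R / 2) * Num.sqrt h.
Proof.
move=> gy; have E : K * (1 + n%:R / 2) * Num.sqrt h =
  K * Num.sqrt h + n%:R * K * Num.sqrt h / 2 by field.
rewrite E ler_norml -lerN2 opprK andbC; apply/andP; split.
  exact: doubling_bound h_gt0 w_cont sub_margin _ gy.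
rewrite opprB addrC; apply: doubling_bound h_gt0 _ super_margin _ gy.
by move=> x; apply: cvgN; exact: w_cont.
Qed.

End Comparison.

Theorem theorem1p2 (R : realType) (n : nat) (n_ge1 : (1 <= n)%N) :
  exists C : R -> R -> R,
    (forall L m : R, 0 < C L m) /\
    forall f : 'rV[R]_n -> R,
      lipschitz_cube f ->
      (forall x, cube x -> 0 < f x) ->
      forall (h : R) (wh w : 'rV[R]_n -> R),
        0 < h ->
        (forall x, grid h x -> 0 <= wh x) ->
        S3_maximal_solution h f wh ->
        P3_maximal_solution f w ->
        forall x, grid h x ->
          `|w x - wh x| <= C (lip_seminorm f) (inf (f @` cube)) * Num.sqrt h.
Proof.
(* [Num.max 1 m^-1] is the inverse of [Num.min 1 m] when [m > 0], and it stays
   positive for every real [m] *)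
pose K (L m : R) := (`|L| + 1) * Num.max 1 m^-1.
have K0 L m : 0 < K L m by rewrite mulr_gt0 ?ltr_wpDl// lt_max ltr01.
exists (fun L m => K L m * (1 + n%:R / 2)); split=> [L m|].
  by rewrite mulr_gt0// ltr_pwDl// divr_ge0 ?ler0n.
move=> f lf f0 h wh w h0 _ S3 [u [und usol uw cw]] x gx.
have [m0 mf] := inf_cube_gt0 _ lf f0.
set m := inf _ in m0 mf *; set L := lip_seminorm f.
have LK : `|L| <= Num.min 1 m * K L m.
  have mm : 1 <= Num.min 1 m * Num.max 1 m^-1.
    have [m1|m1] := leP 1 m.
      by rewrite mul1r le_max lexx.
    by rewrite -(mulfV (lt0r_neq0 m0)) ler_pM2l// le_max lexx orbT.
  rewrite /K mulrCA -[leLHS]mulr1 ler_pM// lerDl//.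
apply: (comparison_estimate f u w wh `|L| m (K L m) h) => //.
- exact: ltW.
- move=> y z cy cz; apply: (le_trans (lip_seminormP _ lf _ _ cy cz)).
  by rewrite ler_wpM2r ?sqrtr_ge0// ler_norm.
- exact: (nondecreasing_solution_ge0 _ _ n_ge1 und usol).
- by move=> y /S3[].
Qed.
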